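(* For every finite group $G$ there exists a finite group $H$ such that $\operatorname{Out}(H)\cong G$.
   Context: For a group $H$, $\operatorname{Out}(H):=\operatorname{Aut}(H)/\operatorname{Inn}(H)$ denotes the outer automorphism group, where $\operatorname{Inn}(H)$ is the group of inner automorphisms of $H$. *)

(* Defs.v *)
From mathcomp Require Import all_boot all_fingroup.

Set Implicit Arguments.
Unset Strict Implicit.
Unset Printing Implicit Defensive.

Local Open Scope group_scope.

Section OuterAutomorphisms.

Variables (gT : finGroupType) (H : {group gT}).

Definition Inn : {set {perm gT}} := conj_aut H @* H.
Canonical Inn_group := [group of Inn].

Lemma InnP (a : {perm gT}) :
  reflect (a \in Aut H /\ exists2 x, x \in H & {in H, forall y, a y = y ^ x})
          (a \in Inn).
Proof.
apply: (iffP idP) => [/morphimP[x _ Hx ->] | [AutHa [x Hx def_a]]].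
  by split; [apply: Aut_aut | exists x => // y Hy; rewrite conj_autE].
apply/morphimP; exists x => //; first by rewrite (subsetP (normG H)).
by apply: (eq_Aut AutHa (Aut_aut _ _)) => y Hy; rewrite def_a ?conj_autE.
Qed.

(* A / B is in general the image of 'N_A(B) in 'N(B) / B; since Inn is normal
   in Aut H, nothing is lost in the quotient defining Out. *)
Lemma Inn_normal : Inn <| Aut H.
Proof.
apply/andP; split; first exact: Aut_conj_aut.
apply/subsetP=> a AutHa; rewrite inE; apply/subsetP=> _ /imsetP[b Inn_b ->].
have [AutHb [x Hx def_b]] := InnP _ Inn_b.
apply/InnP; split; first exact: groupJ.
exists (a x) => [|y Hy]; first exact: Aut_closed.
have HaVy: a^-1 y \in H by apply: Aut_closed; rewrite ?groupV.
have -> : (b ^ a) y = a (a^-1 y ^ x) by rewrite /conjg !permM def_b.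
by rewrite -{1}(autmE AutHa) morphJ //= autmE permKV.
Qed.

Definition Out : {set coset_of Inn} := Aut H / Inn.
Canonical Out_group := [group of Out].

End OuterAutomorphisms.

(* Main.v *)
Require Import Defs.
From mathcomp Require Import all_boot all_fingroup.
From mathcomp Require Import all_algebra cyclic finfield zify.

(** The group H is a wreath product whose only outer automorphisms come from
the normalizer of the permutation group at the top of it; the permutation
group is then chosen so that its normalizer is an extension of it by G.

Let P be any group of permutations of a finite set W, and let H be the wreath
product of the affine group AGL(1, p) by P, acting on W * F_p, for a prime p
larger than #|W| + 1 and than the order of Sym W. Let phi be an automorphism
of H. The translations are exactly the solutions of s ^+ p = 1 in H, so phi
preserves them. A translation along one coordinate has at most #|W| * (p - 1)
conjugates, and one along two or more coordinates has at least (p - 1) ^ 2, so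
phi permutes the coordinate axes. Hence, after conjugation by a monomial map,
phi fixes all translations. The translations are their own centralizer in
Sym (W * F_p), so phi now changes every s only by a translation; comparing the
images of the central inversion x |-> - x of the linear part, and dividing by
2, one sees that phi is conjugation by a translation (rigid). Altogether phi
is conjugation by an element of H times the lift of a permutation sigma of W
that normalizes P (aut_aff). As H has trivial centralizer,
Out H is isomorphic to 'N(P) / P (Out_of_normalizer).

It remains to realize G as 'N(P) / P. Take one fibre of N points over each
element x of gT, and P = the product of the symmetric groups of the fibres. Fix
an injective function colour from gT to the integers between 2 and (N - 1) / 2,
and let P act on the set W of those subsets A of gT * 'I_N that are either
singletons, or meet the fibres in numbers of points given by a translate of
colour by an element of G. Permutations of gT * 'I_N that translate the
fibres by an element of G act on W and normalize P. Conversely let sigma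
normalize P. Counting orbits shows that sigma preserves the singletons, so it
induces a permutation tau of gT * 'I_N. A transposition of two points z, z' of
one fibre lies in P, and it fixes A exactly when z and z' are both in A or both
outside; hence on every fibre sigma A is tau A or its complement, and the latter
is too large. So sigma is the action of tau, and since tau carries colour to a
translate of colour, which is injective, tau translates the fibres by an element
of G (tau_slope). Therefore 'N(P) / P is isomorphic to G (vact_quotient). *)

Set Implicit Arguments.
Unset Strict Implicit.
Unset Printing Implicit Defensive.
Import GRing.Theory.
Local Open Scope group_scope.

(** * Outer automorphisms induced by a normalizing group *)

(** First isomorphism theorem for the map sending x to the class of conjugation
by f x: conjugation by f x agrees on H with conjugation by some h in H only when
f x * h^-1 centralizes H, that is, when f x = h. *)
Lemma isog_Out (aT rT : finGroupType) (N K : {group aT}) (H : {group rT})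
    (f : {morphism N >-> rT}) :
    K \subset N -> {in N, forall x, f x \in 'N(H)} -> 'C(H) \subset [1] ->
    {in N, forall x, (f x \in H) = (x \in K)} ->
    {in Aut H, forall a : {perm rT}, exists h x,
       [/\ h \in H, x \in N & {in H, forall y, a y = y ^ (h * f x)}]} ->
  Out H \isog N / K.
Proof.
move=> sKN nHfx cH1 fH autH.
have nI := normal_norm (Inn_normal H).
have caN x : x \in 'N(H) -> conj_aut H x \in 'N(Inn H).
  by move=> _; apply: (subsetP nI); apply: Aut_aut.
pose phi x := coset (Inn H) (conj_aut H (f x)).
have phiM : {in N &, {morph phi : x y / x * y}}.
  move=> x y Nx Ny; rewrite /phi !morphM ?nHfx //; last by rewrite caN ?nHfx.
  by rewrite caN ?nHfx.
pose phi_m := Morphism phiM.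
have ker_phi : 'ker phi_m = K.
  apply/setP=> x; rewrite !inE.
  apply/andP/idP => [[Nx] | Kx]; last first.
    have Nx := subsetP sKN x Kx; split=> //.
    apply/eqP; apply: coset_id; apply: mem_morphim; rewrite ?fH //.
    exact: nHfx.
  move/eqP/coset_idr=> /(_ (caN _ (nHfx x Nx))) /morphimP[h nHh Hh eq_fh].
  suff /(subsetP cH1)/set1P: f x * h^-1 \in 'C(H).
    by move/(canRL (mulgKV _)); rewrite mul1g -fH // => ->.
  apply/centP=> y Hy; apply: commute_sym; apply/commgP/conjg_fixP.
  rewrite conjgM.
  by rewrite -(norm_conj_autE (nHfx x Nx)) // eq_fh norm_conj_autE // conjgK.
rewrite isog_sym; have := first_isog phi_m; rewrite ker_phi.
suff -> : phi_m @* N = Out H by [].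
apply/setP=> b; apply/morphimP/morphimP => [[x Nx _ ->] | [a na Aa ->]].
  by exists (conj_aut H (f x)); rewrite ?caN ?Aut_aut ?nHfx.
have [h [x [Hh Nx def_a]]] := autH a Aa.
have nHh : h \in 'N(H) by rewrite (subsetP (normG H)).
exists x => //.
have -> : a = conj_aut H h * conj_aut H (f x).
  rewrite -morphM ?nHfx //; apply: (eq_Aut Aa (Aut_aut _ _)) => y Hy.
  by rewrite norm_conj_autE ?groupM ?nHfx // def_a.
have Ih : conj_aut H h \in Inn H by apply: mem_morphim.
rewrite /=; have -> : coset (Inn H) (conj_aut H h * conj_aut H (f x))
        = coset (Inn H) (conj_aut H h) * phi x.
  by apply: (morphM (coset_morphism (Inn H))); rewrite caN ?nHfx.
by rewrite coset_id ?mul1g.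
Qed.

(** * The affine wreath product *)

Section Affine.
Variables (W : finType) (F : finFieldType).
Implicit Types (q : {perm W}) (u : {ffun W -> {unit F}}).
Implicit Types (a : {ffun W -> F}) (w : W).

Definition amap_fun q u a (z : W * F) : W * F :=
  (q z.1, val (u z.1) * z.2 + a z.1)%R.

Lemma amap_fun_inj q u a : injective (amap_fun q u a).
Proof.
by move=> [w x] [w' x'] [/= /perm_inj <- /addIr /(mulrI (valP (u w))) ->].
Qed.

Definition amap q u a : {perm W * F} := perm (@amap_fun_inj q u a).

Lemma amapE q u a w x : amap q u a (w, x) = (q w, val (u w) * x + a w)%R.
Proof. by rewrite permE. Qed.

(** The wreath product is generated by its three kinds of elements: permutations
of the coordinates, translations, and diagonal maps. *)
Definition lift q := amap q [ffun=> 1] 0%R.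
Definition trans a := amap 1 [ffun=> 1] a.
Definition scale u := amap 1 u 0%R.

Lemma liftE q w x : lift q (w, x) = (q w, x).
Proof. by rewrite amapE !ffunE mul1r addr0. Qed.

Lemma transE a w x : trans a (w, x) = (w, x + a w)%R.
Proof. by rewrite amapE !ffunE perm1 mul1r. Qed.

Lemma scaleE u w x : scale u (w, x) = (w, val (u w) * x)%R.
Proof. by rewrite amapE !ffunE perm1 addr0. Qed.

Lemma amapM q1 u1 a1 q2 u2 a2 :
  amap q1 u1 a1 * amap q2 u2 a2 =
    amap (q1 * q2) [ffun w => u1 w * u2 (q1 w)]
      [ffun w => val (u2 (q1 w)) * a1 w + a2 (q1 w)]%R.
Proof.
apply/permP=> -[w x]; rewrite permM !amapE permM !ffunE /=.
by rewrite mulrDr !mulrA addrA [(val (u1 w) * _)%R]mulrC.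
Qed.

Lemma amap_decomp q u a :
  amap q u a = scale u * lift q * trans [ffun w => a (q^-1 w)].
Proof.
apply/permP=> -[w x].
by rewrite !permM scaleE liftE transE amapE ffunE permK.
Qed.

Lemma liftM q1 q2 : lift (q1 * q2) = lift q1 * lift q2.
Proof. by apply/permP=> -[w x]; rewrite permM !liftE permM. Qed.

Lemma transD a b : trans (a + b)%R = trans a * trans b.
Proof. by apply/permP=> -[w x]; rewrite permM !transE !ffunE addrA. Qed.

Lemma trans0 : trans 0%R = 1.
Proof. by apply/permP=> -[w x]; rewrite transE ffunE addr0 perm1. Qed.

Lemma transN a : trans (- a)%R = (trans a)^-1.
Proof. by apply/eqP; rewrite eq_sym eq_invg_mul -transD subrr trans0. Qed.

Lemma transX a n : trans (a *+ n)%R = trans a ^+ n.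
Proof.
by elim: n => [|n IHn]; rewrite ?mulr0n ?trans0 // mulrS transD IHn expgS.
Qed.

Lemma trans_inj : injective trans.
Proof.
move=> a b eq_ab; apply/ffunP=> w.
by have /permP/(_ (w, 0%R)) := eq_ab; rewrite !transE !add0r => -[].
Qed.

Lemma transC a b : commute (trans a) (trans b).
Proof. by rewrite /commute -!transD addrC. Qed.

Lemma transJ q u a b :
  trans a ^ amap q u b =
    trans [ffun w => val (u (q^-1 w)%g) * a (q^-1 w)%g]%R.
Proof.
apply: (mulgI (amap q u b)); rewrite -conjgC.
apply/permP=> -[w x]; rewrite !permM transE 2!amapE transE ffunE permK.
by rewrite mulrDr addrAC.
Qed.

(** For a group Q, the wreath product of the affine group of F by Q. *)
Definition aff (Q : {set {perm W}}) : {set {perm W * F}} :=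
  [set s | [exists q in Q, exists u : {ffun W -> {unit F}},
             exists a : {ffun W -> F}, s == amap q u a]].

Lemma affP (Q : {set {perm W}}) s :
  reflect (exists q u a, q \in Q /\ s = amap q u a) (s \in aff Q).
Proof.
rewrite inE; apply: (iffP exists_inP) => [[q Qq] | [q [u [a [Qq ->]]]]].
  by case/existsP=> u /existsP[a /eqP->]; exists q, u, a.
by exists q => //; apply/existsP; exists u; apply/existsP; exists a.
Qed.

Lemma amap_aff (Q : {set {perm W}}) q u a : (amap q u a \in aff Q) = (q \in Q).
Proof.
apply/affP/idP=> [[r [v [b [Qr /permP eq_s]]]] | Qq]; last by exists q, u, a.
suff -> : q = r by [].
by apply/permP=> w; have := eq_s (w, 0%R); rewrite !amapE => -[].
Qed.

Lemma aff_group_set (P : {group {perm W}}) : group_set (aff P).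
Proof.
apply/group_setP; split; first by rewrite -trans0 amap_aff.
move=> _ _ /affP[q [u [a [Pq ->]]]] /affP[r [v [b [Pr ->]]]].
by rewrite amapM amap_aff groupM.
Qed.
Canonical aff_group P := Group (aff_group_set P).

Lemma lift_norm (P : {group {perm W}}) q : q \in 'N(P) -> lift q \in 'N(aff P).
Proof.
move=> Nq; rewrite inE.
apply/subsetP=> _ /imsetP[_ /affP[r [u [a [Pr ->]]]] ->].
have -> : amap r u a ^ lift q =
   amap (r ^ q) [ffun w => u (q^-1 w)] [ffun w => a (q^-1 w)].
  apply: (mulgI (lift q)); rewrite -conjgC.
  apply/permP=> -[w x]; rewrite !permM amapE !liftE amapE !ffunE.
  by rewrite !permK -[in RHS]permM -conjgC permM.
by rewrite amap_aff memJ_norm.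
Qed.

Definition delta w : {ffun W -> F} := [ffun w' => (w' == w)%:R]%R.

Hypothesis F_nat : forall x : F, exists n, x = n%:R%R.

(** Over a prime field the translations by basis vectors generate all the
translations. *)
Lemma trans_gen (K : {group {perm W * F}}) :
  (forall w, trans (delta w) \in K) -> forall a, trans a \in K.
Proof.
move=> Kd a; have -> : a = (\sum_w [ffun w' => a w * delta w w'])%R.
  apply/ffunP=> w; rewrite sum_ffunE (bigD1 w) //= big1 => [|w' ne_w].
    by rewrite !ffunE eqxx mulr1 addr0.
  by rewrite !ffunE eq_sym (negPf ne_w) mulr0.
elim/big_ind: _ => [|b c Kb Kc|w _]; first by rewrite trans0.
  by rewrite transD groupM.
have [n ->] := F_nat (a w).
have -> : [ffun w' => n%:R * delta w w']%R = (delta w *+ n)%R.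
  by apply/ffunP=> w'; rewrite ffunMnE ffunE mulr_natl.
by rewrite transX groupX.
Qed.

(** The translations act regularly on each copy of F, and those along the
coordinate w move the copy over w only; so a permutation that commutes with all
of them preserves every copy, and is a translation there. *)
Lemma cent_trans (s : {perm W * F}) :
  (forall a, commute s (trans a)) -> exists a, s = trans a.
Proof.
move=> cs.
have s0 w : (s (w, 0%R)).1 = w.
  have /permP/(_ (w, 0%R)) := cs (delta w); rewrite !permM transE !ffunE eqxx.
  case def_s: (s (w, 0%R)) => [w' x]; rewrite transE ffunE.
  case: eqP => // _; rewrite addr0 add0r -def_s => /perm_inj[] /eqP.
  by rewrite eq_sym oner_eq0.
exists [ffun w => (s (w, 0)).2]%R; apply/permP=> -[w x].
have /permP/(_ (w, 0%R)) := cs [ffun=> x].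
rewrite !permM (transE _ w 0%R) ffunE add0r => <-.
rewrite [in RHS]transE ffunE; move: (s0 w); case: (s _) => w' y /= ->.
by rewrite transE ffunE addrC.
Qed.

Definition minus1 : {unit F} := FinRing.unit F (@unitrN1 F).
Definition neg := scale [ffun=> minus1].

Lemma transJneg a : trans a ^ neg = trans (- a)%R.
Proof.
rewrite transJ; congr trans; apply/ffunP=> w.
by rewrite !ffunE invg1 perm1 mulN1r.
Qed.

Lemma neg_commute q u : commute (scale u * lift q) neg.
Proof.
apply/permP=> -[w x].
by rewrite !(permM, scaleE, liftE, ffunE) /= !mulN1r mulrN.
Qed.

Hypothesis F_odd : (2 : F)%R != 0%R.

Lemma commute_neg_trans a : commute neg (trans a) -> a = 0%R.
Proof.
move=> /commute_sym/commgP/conjg_fixP; rewrite transJneg => /trans_inj aN.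
apply/ffunP=> w; rewrite ffunE; apply/eqP.
have /ffunP/(_ w)/eqP := aN; rewrite ffunE eq_sym -addr_eq0 -mulr2n -mulr_natl.
by rewrite mulf_eq0 (negPf F_odd).
Qed.

Lemma neg_aff (P : {group {perm W}}) : neg \in aff P.
Proof. by rewrite amap_aff. Qed.

Lemma trans_aff (P : {group {perm W}}) a : trans a \in aff P.
Proof. by rewrite amap_aff. Qed.

Lemma cent_aff (P : {group {perm W}}) : 'C(aff P) \subset [1].
Proof.
apply/subsetP=> s /centP cs; apply/set1P.
have [a def_s] : exists a, s = trans a.
  by apply: cent_trans => a; apply: cs; apply: trans_aff.
rewrite def_s; rewrite def_s in cs.
by rewrite (commute_neg_trans (commute_sym (cs _ (neg_aff P)))) trans0.
Qed.

(** * Automorphisms that fix the translations *)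

Section Rigid.
Variables (P : {group {perm W}}) (psi : {perm W * F} -> {perm W * F}).
Hypothesis psiM : {in aff P &, {morph psi : s t / s * t}}.
Hypothesis psi_trans : forall a, psi (trans a) = trans a.

(** Both psi s and s induce the same conjugation on the translations, so they
differ by an element of their centralizer. *)
Lemma rigid_cocycle s : s \in aff P -> exists c, psi s = trans c * s.
Proof.
move=> Hs; have psiJ a : trans a ^ psi s = trans a ^ s.
  apply: (mulgI (psi s)); rewrite -conjgC -{1}psi_trans -psiM ?trans_aff //.
  have [b def_b] : exists b, trans a ^ s = trans b.
    by have /affP[q [u [c [_ ->]]]] := Hs; rewrite transJ; eexists.
  by rewrite [trans a * s]conjgC def_b psiM ?trans_aff // psi_trans.
have [a|c def_c] := @cent_trans (psi s * s^-1).
  apply/commute_sym/commgP/conjg_fixP.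
  by rewrite conjgM psiJ conjgK.
by exists c; rewrite -def_c mulgKV.
Qed.

(** The linear part of the wreath product commutes with neg, while no
nontrivial translation does; this forces the cocycle to vanish on the linear
part. *)
Lemma rigid_neg : psi neg = neg -> {in aff P, psi =1 id}.
Proof.
move=> psi_neg _ /affP[q [u [a [Pq ->]]]]; rewrite amap_decomp.
set s := scale u * lift q.
have Hs : s \in aff P by rewrite groupM ?amap_aff.
rewrite psiM ?trans_aff // psi_trans; congr (_ * _).
have [c def_c] := rigid_cocycle Hs.
have cneg : commute neg (psi s).
  by rewrite /commute -psi_neg -!psiM ?neg_aff // (neg_commute q u).
suff c0 : c = 0%R by rewrite def_c c0 trans0 mul1g.
apply: commute_neg_trans; rewrite -(mulgK s (trans c)) -def_c.
by apply: commuteM => //; apply: commuteV; apply/commute_sym/neg_commute.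
Qed.
End Rigid.

(** Since neg inverts translations, neg ^ trans b = trans (- 2 b) * neg; a
suitable b therefore reduces to the case where psi fixes neg. *)
Lemma rigid (P : {group {perm W}}) (psi : {perm W * F} -> {perm W * F}) :
    {in aff P &, {morph psi : s t / s * t}} ->
    (forall a, psi (trans a) = trans a) ->
  exists b, {in aff P, forall s, psi s = s ^ trans b}.
Proof.
move=> psiM psi_trans.
have [c def_c] := rigid_cocycle psiM psi_trans (neg_aff P).
pose b := [ffun w => - (c w / 2)]%R.
exists b => s Hs.
pose psi' s := psi s ^ (trans b)^-1.
suff eq_s : psi' s = s by rewrite -[in RHS]eq_s /psi' conjgKV.
apply: (@rigid_neg P psi' _ _ _ s Hs) => [r t Hr Ht | a |].
- by rewrite /psi' psiM // conjMg.
- by rewrite /psi' psi_trans conjgE invgK mulgA (transC b) mulgK.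
rewrite /psi' def_c; suff -> : trans c * neg = neg ^ trans b by rewrite conjgK.
rewrite conjgE; have -> : neg * trans b = trans (- b)%R * neg.
  by rewrite [RHS]conjgC transJneg opprK.
rewrite -transN mulgA -transD; congr (trans _ * _); apply/ffunP=> w.
by rewrite !ffunE opprK -mulr2n -[RHS]mulr_natr divfK.
Qed.

(** * Characteristic features of the wreath product *)

Lemma liftJ q r : lift (q ^ r) = lift q ^ lift r.
Proof. by apply: (mulgI (lift r)); rewrite -conjgC -!liftM -conjgC. Qed.

Lemma amapX q u a n :
  exists v b, amap q u a ^+ n = amap (q ^+ n) v b.
Proof.
elim: n => [|n [v [b IHn]]]; first by rewrite !expg0 -trans0; do 2!eexists.
by rewrite !expgS IHn amapM; do 2!eexists.
Qed.

Lemma amapX1 u a n :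
  exists b, amap 1 u a ^+ n = amap 1 [ffun w => u w ^+ n] b.
Proof.
elim: n => [|n [b IHn]].
  by exists 0%R; rewrite expg0 -trans0; congr amap; apply/ffunP=> w;
    rewrite !ffunE.
rewrite expgS IHn amapM mulg1; eexists; congr amap.
by apply/ffunP=> w; rewrite !ffunE perm1 expgS.
Qed.

Lemma amap_eq1 q u a : amap q u a = 1 -> [/\ q = 1, u = [ffun=> 1] & a = 0%R].
Proof.
move/permP=> eq1.
have eq_w w x : (q w = w) /\ (val (u w) * x + a w = x)%R.
  by have := eq1 (w, x); rewrite amapE perm1 => -[].
split; first by apply/permP=> w; rewrite perm1; case: (eq_w w 0%R).
  apply/ffunP=> w; rewrite ffunE; apply: val_inj.
  have [_] := eq_w w 0%R; rewrite mulr0 add0r => a0.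
  by have [_] := eq_w w 1%R; rewrite a0 addr0 mulr1.
by apply/ffunP=> w; have [_] := eq_w w 0%R; rewrite mulr0 add0r ffunE.
Qed.

Variable p : nat.
Hypotheses (p_prime : prime p) (cardF : #|F| = p) (charF : (p%:R = 0 :> F)%R).

Lemma card_unitF : #|{: {unit F}}| = p.-1.
Proof. by rewrite -cardF -card_finField_unit cardsT. Qed.

Hypothesis p_gt_perm : #|{perm W}| < p.

Lemma trans_expp a : trans a ^+ p = 1.
Proof.
rewrite -transX -trans0; congr trans; apply/ffunP=> w.
by rewrite ffunMnE ffunE -mulr_natl charF mul0r.
Qed.

(** The permutation part has order dividing p, and p exceeds the order of the
symmetric group; the scaling part has order dividing both p and p - 1. *)
Lemma expp_trans q u b : amap q u b ^+ p = 1 -> exists a, amap q u b = trans a.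
Proof.
move=> sp1; have q1 : q = 1.
  have [v [c def_s]] := amapX q u b p; rewrite sp1 in def_s.
  have [/eqP qp1 _ _] := amap_eq1 (esym def_s).
  move: qp1; rewrite -order_dvdn => /(prime_nt_dvdP p_prime) ordq.
  apply/eqP; rewrite -order_eq1; apply: contraLR p_gt_perm => /ordq <-.
  by rewrite -leqNgt max_card.
rewrite q1 in sp1 *; have [c def_s] := amapX1 u b p; rewrite sp1 in def_s.
have [_ /ffunP up1 _] := amap_eq1 (esym def_s).
suff -> : u = [ffun=> 1] by exists b.
apply/ffunP=> w; have := up1 w; rewrite !ffunE.
rewrite -(prednK (prime_gt0 p_prime)) expgS -card_unitF -cardsT.
rewrite expg_cardG ?inE //.
by rewrite mulg1.
Qed.

Definition line w (v : {unit F}) : {ffun W -> F} :=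
  [ffun w' => val v * delta w w']%R.

Lemma delta_transJ w q u b :
  trans (delta w) ^ amap q u b = trans (line (q w) (u w)).
Proof.
rewrite transJ; congr trans; apply/ffunP=> w'.
rewrite !ffunE (canF_eq (permKV q)).
by case: eqP => [->|]; rewrite ?permK // !mulr0.
Qed.

(** The conjugates of a basis translation are translations along an axis. *)
Lemma class_delta (P : {group {perm W}}) w :
  #|trans (delta w) ^: aff P| <= #|W| * p.-1.
Proof.
rewrite -card_unitF -card_prod -cardsT.
apply: leq_trans (leq_imset_card (fun iv => trans (line iv.1 iv.2)) _).
apply/subset_leq_card/subsetP=> _ /imsetP[_ /affP[q [u [b [_ ->]]]] ->].
by rewrite delta_transJ; apply/imsetP; exists (q w, u w).
Qed.

(** Rescaling two nonzero coordinates independently gives distinct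
conjugates. *)
Lemma class_large (P : {group {perm W}}) a i j :
    i != j -> a i != 0%R -> a j != 0%R ->
  p.-1 * p.-1 <= #|trans a ^: aff P|.
Proof.
move=> ne_ij ai aj; rewrite -card_unitF -card_prod.
pose f (v : {unit F} * {unit F}) := trans a ^
  scale [ffun w => if w == i then v.1 else if w == j then v.2 else 1].
have f_inj : injective f.
  move=> [v1 v2] [v1' v2']; rewrite /f !transJ => /trans_inj/ffunP eq_f.
  have := eq_f i; have := eq_f j; rewrite !ffunE !invg1 !perm1 !eqxx.
  rewrite eq_sym (negPf ne_ij) /= => /(mulIf aj)/val_inj->.
  move=> /(mulIf ai)/val_inj->.
  by [].
rewrite -(card_imset _ f_inj); apply/subset_leq_card/subsetP.
move=> _ /imsetP[v _ ->].
by apply: memJ_class; rewrite amap_aff.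
Qed.

Hypothesis p_gt_W : #|W| < p.-1.

Lemma class_small (P : {group {perm W}}) a :
    a != 0%R -> #|trans a ^: aff P| <= #|W| * p.-1 ->
  exists iv, a = line iv.1 iv.2.
Proof.
move=> nz_a small; have [i ai] : exists i, a i != 0%R.
  apply/existsP; apply: contraR nz_a => /existsPn a0; apply/eqP/ffunP=> w.
  by rewrite ffunE; apply/eqP/negPn/a0.
have Ui : (a i \is a GRing.unit)%R by rewrite unitfE.
exists (i, FinRing.unit F Ui); apply/ffunP=> j; rewrite !ffunE.
case: (eqVneq j i) => [->|ne_ji]; first by rewrite mulr1.
rewrite mulr0; apply/eqP; apply: contraLR small => aj.
rewrite -ltnNge (leq_trans _ (class_large P ne_ji aj ai)) //.
by rewrite ltn_pmul2r // (leq_ltn_trans _ p_gt_W).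
Qed.

(** * Automorphisms of the wreath product *)

Section AutAff.
Variables (P : {group {perm W}}) (phi : {perm {perm W * F}}).
Hypothesis Aut_phi : phi \in Aut (aff P).

Lemma phi_aff s : s \in aff P -> phi s \in aff P.
Proof. by move=> Hs; apply: Aut_closed. Qed.

Lemma phiM : {in aff P &, {morph phi : s t / s * t}}.
Proof. by move=> s t Hs Ht; rewrite -!(autmE Aut_phi) morphM. Qed.

Lemma phiJ : {in aff P &, {morph phi : s t / s ^ t}}.
Proof. by move=> s t Hs Ht; rewrite -!(autmE Aut_phi) morphJ. Qed.

Lemma phi_trans a : exists b, phi (trans a) = trans b.
Proof.
have Ha := trans_aff P a.
have /affP[q [u [b [_ def_s]]]] := phi_aff Ha; rewrite def_s.
apply: expp_trans; rewrite -def_s -!(autmE Aut_phi) -morphX //.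
by rewrite trans_expp morph1.
Qed.

(** The image of a basis translation has as many conjugates as the basis
translation, which is too few for a vector off the axes. *)
Lemma phi_delta w : exists iv, phi (trans (delta w)) = trans (line iv.1 iv.2).
Proof.
have [b def_b] := phi_trans (delta w).
have [|| iv def_iv] := @class_small P b; last by exists iv; rewrite -def_iv.
  apply/eqP=> b0; have := def_b; rewrite b0 trans0 => /eqP.
  have Hd := trans_aff P (delta w).
  rewrite -(autmE Aut_phi) morph_injm_eq1 ?injm_autm // -trans0.
  move/eqP/trans_inj/ffunP/(_ w)/eqP; rewrite !ffunE eqxx.
  by rewrite oner_eq0.
apply: leq_trans (class_delta P w); rewrite -def_b.
apply: leq_trans (leq_imset_card phi _); apply/subset_leq_card/subsetP.
move=> _ /imsetP[t Ht ->]; apply/imsetP; exists (trans (delta w) ^ (phi^-1 t)).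
  by apply: memJ_class; rewrite Aut_closed ?groupV.
by rewrite phiJ ?trans_aff ?permKV // Aut_closed ?groupV.
Qed.

(** The axes are permuted by sigma, with factors v. Composing phi with the
conjugation by the inverse of the monomial map m = scale v * lift sigma gives an
automorphism that fixes the basis translations, hence is a conjugation by a
translation. *)
Lemma aut_aff : exists h sigma,
  [/\ h \in aff P, sigma \in 'N(P) &
      {in aff P, forall s, phi s = s ^ (h * lift sigma)}].
Proof.
have [iv phi_iv] := fin_all_exists phi_delta.
have sigma_inj : injective (fun w => (iv w).1).
  move=> i j /= eq_ij.
  (* If two basis vectors had images on the same axis, the image of one would
     be a multiple of the image of the other. *)
  have [n def_n] := F_nat (val (iv j).2 / val (iv i).2)%R.
  have : phi (trans (delta j)) = phi (trans (delta i) ^+ n).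
    have Hi := trans_aff P (delta i).
    have -> : phi (trans (delta i) ^+ n) = phi (trans (delta i)) ^+ n.
      by rewrite -!(autmE Aut_phi) morphX.
    rewrite !phi_iv -transX -eq_ij.
    congr trans; apply/ffunP=> w; rewrite ffunMnE !ffunE.
    rewrite -[RHS]mulr_natl -def_n mulrA divfK //.
    by rewrite -unitfE; apply: (valP (iv i).2).
  move/perm_inj; rewrite -transX => /trans_inj/ffunP/(_ j)/eqP.
  rewrite ffunMnE !ffunE eqxx; case: (eqVneq j i) => [->|_] //.
  by rewrite mulr0n mul0rn oner_eq0.
pose sigma := perm sigma_inj; pose v := [ffun w => (iv w).2].
pose m := scale v * lift sigma.
have def_m : m = amap sigma v 0%R.
  rewrite amap_decomp (_ : [ffun=> _] = 0%R) ?trans0 ?mulg1 //.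
  by apply/ffunP=> w; rewrite !ffunE.
pose psi s := phi s ^ m^-1.
have psiM : {in aff P &, {morph psi : s t / s * t}}.
  by move=> s t Hs Ht; rewrite /psi phiM // conjMg.
have psi_trans a : psi (trans a) = trans a.
  pose K := [set s in aff P | psi s == s].
  have inK s : (s \in K) = (s \in aff P) && (psi s == s) by rewrite !inE.
  have gK : group_set K.
    apply/group_setP; split=> [|s t].
      by rewrite inK group1 /psi -(autmE Aut_phi) morph1 conj1g eqxx.
    rewrite !inK => /andP[Hs /eqP ps] /andP[Ht /eqP pt].
    by rewrite groupM // psiM // ps pt eqxx.
  suff : trans a \in Group gK by rewrite inK => /andP[_ /eqP].
  apply: trans_gen => w; rewrite inK trans_aff /psi phi_iv /=.
  by rewrite -(inj_eq (conjg_inj m)) conjgKV def_m delta_transJ permE ffunE.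
have [b def_psi] := rigid psiM psi_trans.
pose h := trans b * scale v.
have Hh : h \in aff P by rewrite groupM ?amap_aff.
have def_phi : {in aff P, forall s, phi s = s ^ (h * lift sigma)}.
  by move=> s Hs; rewrite -mulgA conjgM -def_psi // conjgKV.
exists h, sigma; split=> //; rewrite inE; apply/subsetP=> _ /imsetP[q Pq ->].
rewrite -(amap_aff P _ [ffun=> 1] 0%R) -/(lift _) liftJ.
have Hq : lift q ^ h^-1 \in aff P by rewrite groupJ ?groupV ?amap_aff.
by have := phi_aff Hq; rewrite def_phi // conjgM conjgKV.
Qed.
End AutAff.
End Affine.

(** * From normalizers of permutation groups to outer automorphism groups *)

Theorem Out_of_normalizer (W : finType) (P : {group {perm W}}) :
  exists (rT : finGroupType) (H : {group rT}), Out H \isog 'N(P) / P.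
Proof.
have [p lt_p p_prime] := prime_above (#|{perm W}| + #|W| + 2).
have cardF : #|'F_p| = p by rewrite card_Fp.
have charF : (p%:R = 0 :> 'F_p)%R by apply: pchar_Fp_0.
have F_nat (x : 'F_p) : exists n, x = (n%:R)%R by exists x; rewrite natr_Zp.
have F_odd : (2 != 0 :> 'F_p)%R.
  rewrite -(dvdn_pcharf (pchar_Fp p_prime)); apply/negP=> /dvdn_leq -/(_ isT).
  by rewrite leqNgt (leq_ltn_trans _ lt_p) // leq_addl.
exists {perm W * 'F_p}, (aff_group 'F_p P).
have liftM' : {in 'N(P) &, {morph @lift W 'F_p : q r / q * r}}.
  by move=> q r _ _; apply: liftM.
apply: (@isog_Out _ _ _ _ _ (Morphism liftM')).
- exact: normG.
- by move=> q; apply: lift_norm.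
- exact: cent_aff.
- by move=> q _; rewrite amap_aff.
move=> phi Aut_phi; apply: (aut_aff F_nat F_odd p_prime cardF charF) => //.
- by rewrite (leq_ltn_trans _ lt_p) // -addnA leq_addr.
- by rewrite -ltnS prednK ?prime_gt0 // (leq_ltn_trans _ lt_p) //; lia.
Qed.

(** * A permutation group with prescribed normalizer quotient *)

Section Profiles.
Variables (gT : finGroupType) (G : {group gT}).
Implicit Types (x y : gT).

(** The constant makes colour take its values between 2 and (width - 1) / 2. *)
Definition width := (2 * #|gT|).+3.
Notation Z := (gT * 'I_width)%type.
Implicit Types (z : Z) (A B : {set Z}) (s t : {perm Z}).

Definition colour x := (enum_rank x + 2)%N.
Definition prof A x := #|[set z in A | z.1 == x]|.
(** Either a singleton, or a set whose profile is a translate of colour by an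
element of G. The orbit of an injective function on gT under translations
remembers the group G. *)
Definition good A :=
  (#|A| == 1%N) || [exists g in G, forall x, prof A (x * g) == colour x].
Definition point := {A : {set Z} | good A}.
Implicit Types (w : point).

Lemma colour_inj : injective colour.
Proof. by move=> x y /addIn/val_inj/enum_rank_inj. Qed.

Lemma colour_ge2 x : 2 <= colour x.
Proof. exact: leq_addl. Qed.

Lemma colour_lt x : 2 * colour x < width.
Proof.
have := ltn_ord (enum_rank x); rewrite /colour /width; set i := nat_of_ord _.
have -> : #|{: gT}| = #|gT| by []. lia.
Qed.

(** The product of the symmetric groups of the fibres. *)
Definition vert : {set {perm Z}} :=
  [set s : {perm Z} | [forall z : Z, (s z).1 == z.1]].
Lemma vertP s : reflect (forall z, (s z).1 = z.1) (s \in vert).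
Proof. by rewrite inE; apply: (iffP forallP) => eqs z; apply/eqP. Qed.
Lemma vert_group_set : group_set vert.
Proof.
apply/group_setP; split=> [|s t /vertP Ks /vertP Kt]; apply/vertP=> z.
  by rewrite perm1.
by rewrite permM Kt Ks.
Qed.
Canonical vert_group := Group vert_group_set.

Lemma vert_tperm z z' : (tperm z z' \in vert) = (z.1 == z'.1).
Proof.
apply/vertP/eqP => [/(_ z)|eq_z t]; first by rewrite tpermL.
by case: tpermP => [->|->|].
Qed.

Lemma shift_subproof x : injective (fun z => (z.1 * x, z.2)).
Proof. by move=> [y i] [y' i'] [/mulIg -> ->]. Qed.
Definition shift x : {perm Z} := perm (@shift_subproof x).

Lemma shiftE x z : shift x z = (z.1 * x, z.2).
Proof. by rewrite permE. Qed.

Lemma shiftM : {morph shift : x y / x * y}.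
Proof. by move=> x y; apply/permP=> z; rewrite permM !shiftE /= mulgA. Qed.

Lemma prof_imset s g A x :
  (forall z, (s z).1 = z.1 * g) -> prof (s @: A) (x * g) = prof A x.
Proof.
move=> sg; rewrite /prof -(card_imset [set z in A | z.1 == x] (@perm_inj _ s)).
apply: eq_card => z; rewrite -(permKV s z) mem_imset ?inE; last exact: perm_inj.
by rewrite mem_imset ?sg ?(inj_eq (mulIg g)) //; apply: perm_inj.
Qed.

Lemma good_imset s g A :
  g \in G -> (forall z, (s z).1 = z.1 * g) -> good A -> good (s @: A).
Proof.
move=> Gg sg /orP[A1 | /exists_inP[h Gh /forallP profA]];
  apply/orP; [left|right].
  by rewrite card_imset //; apply: perm_inj.
apply/exists_inP; exists (h * g); first exact: groupM.
by apply/forallP=> x; rewrite mulgA (prof_imset _ _ sg).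
Qed.

(** Permutations of Z that do not preserve the points act trivially. *)
Definition act := actperm (@subaction _ _ _ good point ('P^*)%act).

(** Right translations make the slope multiplicative, since the product of
permutations applies its left factor first. *)
Definition slope s g := forall z, (s z).1 = z.1 * g.

Lemma slopeM s t g h : slope s g -> slope t h -> slope (s * t) (g * h).
Proof. by move=> sg th z; rewrite permM th sg mulgA. Qed.

Lemma slope_vert s : s \in vert -> slope s 1.
Proof. by move/vertP=> Ks z; rewrite mulg1. Qed.

Lemma slope_shift g : slope (shift g) g.
Proof. by move=> z; rewrite shiftE. Qed.

Lemma actE s g w : g \in G -> slope s g -> val (act s w) = s @: val w.
Proof.
move=> Gg sg; have setact_s A : ('P^* A s)%act = s @: A.
  by apply: eq_imset => z; apply: apermE.
rewrite actpermE val_subact setact_s ifT // !inE.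
by apply/subsetP=> A /[!inE] goodA; rewrite setact_s (good_imset Gg).
Qed.

Lemma act_in s g w z :
  g \in G -> slope s g -> (s z \in val (act s w)) = (z \in val w).
Proof.
by move=> Gg sg; rewrite (actE _ Gg sg) mem_imset //; apply: perm_inj.
Qed.

Lemma actM s t g h : g \in G -> h \in G -> slope s g -> slope t h ->
  act (s * t) = act s * act t.
Proof.
move=> Gg Gh sg th; apply/permP=> w; apply: val_inj.
rewrite permM (actE _ Gh th) (actE _ Gg sg).
rewrite (actE _ _ (slopeM sg th)) ?groupM //.
by rewrite -imset_comp; apply: eq_imset => z; rewrite permM.
Qed.

Lemma pt_subproof z : good [set z].
Proof. by rewrite /good cards1. Qed.
Definition pt z : point := Sub [set z] (pt_subproof z).

Lemma pt_inj : injective pt.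
Proof. by move=> z z' /(congr1 val) /= /set1_inj. Qed.

Lemma act_pt s g z : g \in G -> slope s g -> act s (pt z) = pt (s z).
Proof.
by move=> Gg sg; apply: val_inj; rewrite (actE _ Gg sg) /= imset_set1.
Qed.

Lemma act_inj s t g h : g \in G -> h \in G -> slope s g -> slope t h ->
  act s = act t -> s = t.
Proof.
move=> Gg Gh sg th eq_st; apply/permP=> z; apply: pt_inj.
by rewrite -(act_pt _ Gg sg) -(act_pt _ Gh th) eq_st.
Qed.

Definition vact : {set {perm point}} := [set act s | s in vert].

Lemma vact_group_set : group_set vact.
Proof.
apply/group_setP; split=> [|_ _ /imsetP[s Ks ->] /imsetP[t Kt ->]].
  apply/imsetP; exists 1; rewrite ?group1 //; apply/permP=> w; apply: val_inj.
  rewrite (actE _ (group1 G) (slope_vert (group1 _))) perm1.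
  by rewrite -[LHS]imset_id; apply: eq_imset => z; rewrite perm1.
rewrite -(actM (group1 G) (group1 G) (slope_vert Ks) (slope_vert Kt)).
by apply: imset_f; apply: groupM.
Qed.
Canonical vact_group := Group vact_group_set.

Lemma act_shift_norm g : g \in G -> act (shift g) \in 'N(vact).
Proof.
move=> Gg; rewrite inE; apply/subsetP=> _ /imsetP[_ /imsetP[s Ks ->] ->].
have Ksg : s ^ shift g \in vert.
  apply/vertP=> z; rewrite -(permKV (shift g) z); set y := _ z.
  by rewrite -permM -conjgC permM !shiftE /=; move/vertP: Ks => ->.
apply/imsetP; exists (s ^ shift g) => //.
apply: (mulgI (act (shift g))); rewrite -conjgC.
rewrite -(actM (group1 G) Gg (slope_vert Ks) (@slope_shift g)) [s * _]conjgC.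
exact: actM Gg (group1 G) (@slope_shift g) (slope_vert Ksg).
Qed.

(** * Singletons are recognized by the size of their orbits *)

Definition orb w : {set point} := [set pi w | pi : {perm point} in vact].

Lemma orb_norm (sigma : {perm point}) w :
  sigma \in 'N(vact) -> #|orb (sigma w)| <= #|orb w|.
Proof.
move=> Ns; apply: leq_trans (leq_imset_card sigma _).
apply/subset_leq_card/subsetP=> _ /imsetP[pi Ppi ->].
have -> : pi (sigma w) = sigma ((pi ^ sigma^-1) w).
  by rewrite -!permM [sigma * pi]conjgCV.
by apply: imset_f; apply: imset_f; rewrite memJ_norm ?groupV.
Qed.

Lemma orb_pt z : #|orb (pt z)| <= width.
Proof.
rewrite -[X in _ <= X]card_ord -cardsT.
apply: leq_trans (leq_imset_card (fun b => pt (z.1, b)) _).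
apply/subset_leq_card/subsetP=> _ /imsetP[_ /imsetP[s Ks ->] ->].
rewrite (act_pt _ (group1 G) (slope_vert Ks)) [s z]surjective_pairing.
by move/vertP: Ks => ->; apply: imset_f.
Qed.

Lemma card_fibre y : #|[set z : Z | z.1 == y]| = width.
Proof.
have pair_inj : injective (fun b : 'I_width => (y, b)) by move=> b b' [].
rewrite -[RHS]card_ord -cardsT -(card_imset _ pair_inj).
apply: eq_card => -[y' b]; rewrite !inE /=.
apply/eqP/imsetP=> [->|[b' _ [->]]//].
by exists b.
Qed.

(** Exchanging a point of the set with a point outside it in the fibre over y
gives k * (width - k) distinct sets, where k = prof (val w) y. *)
Lemma orb_large w y :
  2 <= prof (val w) y -> 2 * prof (val w) y < width -> width < #|orb w|.
Proof.
set A := val w => k_ge2 k_small.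
pose In := [set z in A | z.1 == y]; pose Ex := [set z in ~: A | z.1 == y].
have cardEx : (prof A y + #|Ex|)%N = width.
  rewrite -[RHS](card_fibre y) -[RHS](cardsID A); congr (_ + _)%N.
    by apply: eq_card => z; rewrite !inE andbC.
  by apply: eq_card => z; rewrite !inE.
have slope_t z z' : z \in In -> z' \in Ex -> slope (tperm z z') 1.
  rewrite !inE => /andP[_ /eqP zy] /andP[_ /eqP z'y].
  by apply: slope_vert; rewrite vert_tperm zy z'y.
pose f zz := act (tperm zz.1 zz.2) w.
have f_mem z z' u : z \in In -> z' \in Ex ->
    (u \in val (f (z, z'))) = (tperm z z' u \in A).
  move=> Iz Ez; rewrite -{1}(tpermK z z' u).
  by rewrite (act_in _ _ (group1 G) (slope_t z z' Iz Ez)).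
have f_inj : {in setX In Ex &, injective f}.
  move=> [z z'] [u u'] /setXP[/= Iz Ez] /setXP[/= Iu Eu] eq_f.
  have [Az Au] : z \in A /\ u \in A.
    by move: Iz Iu; rewrite !inE => /andP[? _] /andP[? _].
  have [nAz nAu] : z' \notin A /\ u' \notin A.
    by move: Ez Eu; rewrite !inE => /andP[? _] /andP[? _].
  have := f_mem _ _ z Iu Eu; rewrite -eq_f f_mem // tpermL (negPf nAz).
  case: tpermP => [-> _|eq_zu'|_ _]; rewrite ?Az //; last first.
    by move=> _; move: nAu; rewrite -eq_zu' Az.
  have := f_mem _ _ z' Iu Eu; rewrite -eq_f f_mem // tpermR Az.
  case: tpermP => [eq_z'u|->|_ _] //; last by rewrite (negPf nAz).
  by move: nAz; rewrite eq_z'u Au.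
apply: (@leq_trans #|setX In Ex|).
  rewrite cardsX -/(prof A y); move: k_ge2 k_small cardEx.
  set k := prof A y; set e := #|Ex|; set n := width => *; nia.
rewrite -(card_in_imset f_inj); apply/subset_leq_card/subsetP.
move=> _ /imsetP[[z z'] /setXP[/= Iz Ez] ->]; apply: imset_f; apply: imset_f.
rewrite vert_tperm.
by move: Iz Ez; rewrite !inE => /andP[_ /eqP->] /andP[_ /eqP->].
Qed.

Lemma point_prof w : #|val w| != 1%N ->
  exists2 g, g \in G & forall x, prof (val w) (x * g) = colour x.
Proof.
move=> not1; have := valP w; rewrite /good (negPf not1) /=.
by case/exists_inP=> g Gg /forallP prof_w; exists g => // x; apply/eqP.
Qed.

(** A normalizing permutation does not increase orbit sizes, and the orbit of a
point that is not a singleton has more than width elements. *)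
Lemma norm_pt (sigma : {perm point}) z :
  sigma \in 'N(vact) -> exists z', sigma (pt z) = pt z'.
Proof.
move=> Ns.
have [/eqP/cards1P[z' eq_z'] | not1] := eqVneq #|val (sigma (pt z))| 1%N.
  by exists z'; apply: val_inj.
have [g _ prof_g] := point_prof not1.
have := leq_trans (orb_norm (pt z) Ns) (orb_pt z).
by rewrite leqNgt (@orb_large _ (1 * g)) ?prof_g ?colour_ge2 ?colour_lt.
Qed.

Definition base_set : {set Z} := [set z : Z | z.2 < colour z.1].

Lemma base_prof x : prof base_set x = colour x.
Proof.
rewrite /prof.
have le_x : colour x <= width by have := colour_lt x; lia.
have emb_inj : injective (fun i : 'I_(colour x) => (x, widen_ord le_x i)).
  by move=> i j [/val_inj].
rewrite -[RHS]card_ord -cardsT -(card_imset _ emb_inj).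
apply: eq_card => -[y b]; rewrite !inE /=.
apply/andP/imsetP=> [[lt_b /eqP eq_y]|].
  rewrite eq_y in lt_b *; exists (Ordinal lt_b) => //.
  by congr (_, _); apply: val_inj.
by case=> i _ [-> ->] /=; rewrite ltn_ord.
Qed.

Lemma base_subproof : good base_set.
Proof.
apply/orP; right; apply/exists_inP; exists 1 => //; apply/forallP=> x.
by rewrite mulg1 base_prof.
Qed.
Definition base : point := Sub base_set base_subproof.

Lemma base_large : #|val base| != 1%N.
Proof.
rewrite neq_ltn orbC; apply/orP; left; apply: leq_trans (colour_ge2 1) _.
rewrite -base_prof; apply/subset_leq_card/subsetP=> z.
by rewrite inE => /andP[].
Qed.

(** * The normalizer of the fibrewise permutations *)

Section Normalizer.
Variable sigma : {perm point}.
Hypothesis Nsigma : sigma \in 'N(vact).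

Lemma normalizer_perm :
  exists tau : {perm Z}, forall z, sigma (pt z) = pt (tau z).
Proof.
have [tau tauE] := fin_all_exists (fun z => norm_pt z Nsigma).
have tau_inj : injective tau.
  by move=> z z' eq_t; apply/pt_inj/(@perm_inj _ sigma); rewrite !tauE eq_t.
by exists (perm tau_inj) => z; rewrite permE.
Qed.

Variable tau : {perm Z}.
Hypothesis tauE : forall z, sigma (pt z) = pt (tau z).

(** If act s ^ sigma is act t, then t is s ^ tau, as seen on singletons. *)
Lemma normalizer_conj s : s \in vert ->
  s ^ tau \in vert /\ forall w, sigma (act s w) = act (s ^ tau) (sigma w).
Proof.
move=> Ks; have s1 := slope_vert Ks.
have [t Kt def_t] : exists2 t, t \in vert & act s ^ sigma = act t.
  by apply/imsetP; rewrite memJ_norm //; apply: imset_f.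
have eq_act w : sigma (act s w) = act t (sigma w).
  by rewrite -def_t -!permM -conjgC.
suff -> : s ^ tau = t by [].
apply: (mulgI tau); rewrite -conjgC; apply/permP=> z; apply: pt_inj.
rewrite !permM -tauE -(act_pt _ (group1 G) s1) eq_act tauE.
by rewrite (act_pt _ (group1 G) (slope_vert Kt)).
Qed.

(** Two points lie in the same fibre exactly when their transposition preserves
the fibres. *)
Lemma tau_fibre z z' : z.1 = z'.1 -> (tau z).1 = (tau z').1.
Proof.
move=> eq_z; have Kt : tperm z z' \in vert by rewrite vert_tperm eq_z.
by have [+ _] := normalizer_conj Kt; rewrite tpermJ vert_tperm => /eqP.
Qed.

Definition base_tau x := (tau (x, ord0)).1.

Lemma tau_base z : (tau z).1 = base_tau z.1.
Proof. exact: tau_fibre. Qed.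

Lemma base_tau_inj : injective base_tau.
Proof.
have tauK : cancel (fun y => (tau^-1 (y, ord0)).1) base_tau.
  by move=> y; rewrite -tau_base permKV.
exact: can_inj (canF_sym tauK).
Qed.

Lemma tperm_fix w z z' : z.1 = z'.1 ->
  (act (tperm z z') w == w) = ((z \in val w) == (z' \in val w)).
Proof.
move=> eq_z; have Kt : tperm z z' \in vert by rewrite vert_tperm eq_z.
have memt := act_in w _ (group1 G) (slope_vert Kt).
apply/eqP/eqP=> [fix_w | eq_w].
  by have := memt z; rewrite fix_w tpermL.
apply/val_inj/setP=> u; rewrite -{1}(tpermK z z' u) memt.
by case: tpermP => [->|->|_ _].
Qed.

(** Both sides say that the transposition of z and z', or its conjugate by tau,
fixes the corresponding point. *)
Lemma tau_iff w z z' : z.1 = z'.1 ->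
  ((z \in val w) == (z' \in val w)) =
    ((tau z \in val (sigma w)) == (tau z' \in val (sigma w))).
Proof.
move=> eq_z; have Kt : tperm z z' \in vert by rewrite vert_tperm eq_z.
have [_ eq_act] := normalizer_conj Kt.
rewrite -!tperm_fix //; last exact: tau_fibre.
by rewrite -(inj_eq (@perm_inj _ sigma)) eq_act tpermJ.
Qed.

Lemma norm_large w : #|val w| != 1%N -> #|val (sigma w)| != 1%N.
Proof.
apply: contra => /cards1P[u def_u].
have NsV : sigma^-1 \in 'N(vact) by rewrite groupV.
have [v def_v] := norm_pt u NsV.
suff -> : w = pt v by rewrite /= cards1.
by rewrite -def_v -[w](permK sigma); congr (_ _); apply: val_inj.
Qed.

(** By tau_iff, if the equality fails at z then it fails on the whole fibre of
z, which is then covered by the subset w and by the preimage under tau of the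
subset sigma w; each contains less than half of it. *)
Lemma tau_large w z : #|val w| != 1%N ->
  (tau z \in val (sigma w)) = (z \in val w).
Proof.
move=> not1; have not1s := norm_large not1.
set A := val w; set B := val (sigma w).
have prof_small C y : C = A \/ C = B -> 2 * prof C y < width.
  case=> ->;
    [have [g _ pg] := point_prof not1 | have [g _ pg] := point_prof not1s];
    by rewrite -(mulgKV g y) pg colour_lt.
apply/eqP; apply: contraLR (prof_small A z.1 (or_introl erefl)) => neq_z.
pose F := [set u : Z | u.1 == z.1].
pose FB := [set u in F | tau u \in B].
have leFB : #|FB| <= prof B (base_tau z.1).
  rewrite -(card_imset FB (@perm_inj _ tau)); apply/subset_leq_card/subsetP.
  move=> _ /imsetP[u + ->]; rewrite !inE => /andP[/eqP uz ->] /=.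
  by rewrite tau_base uz.
have : width <= prof A z.1 + #|FB|.
  apply: (@leq_trans #|F|); first by rewrite card_fibre.
  apply: leq_trans (leq_card_setU _ _).
  apply/subset_leq_card/subsetP=> u; rewrite !inE => Fu; rewrite Fu andbT /=.
  have := tau_iff w (eqP Fu); rewrite -/A -/B; move: neq_z.
  by case: (tau z \in B); case: (z \in A); case: (u \in A); case: (tau u \in B).
have := prof_small B (base_tau z.1) (or_intror erefl).
by move: leFB; lia.
Qed.

(** Applying sigma to the set base shows that tau turns colour into a translate
of itself by an element of G; as colour is injective, tau acts on the fibres as
that translation. *)
Lemma tau_slope : exists2 g, g \in G & slope tau g.
Proof.
have [g Gg prof_g] := point_prof (norm_large base_large).
exists g => // z; rewrite tau_base; apply: (canRL (mulgKV g)).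
apply: colour_inj; rewrite -prof_g mulgKV -base_prof.
rewrite /prof -(card_imset [set u in base_set | _] (@perm_inj _ tau)).
apply: eq_card => u; rewrite -(permKV tau u) mem_imset ?inE;
  last exact: perm_inj.
by rewrite tau_large ?base_large // tau_base (inj_eq base_tau_inj) inE.
Qed.

Lemma sigma_act g : g \in G -> slope tau g -> sigma = act tau.
Proof.
move=> Gg tg; apply/permP=> w; apply/val_inj.
have [/eqP/cards1P[z def_z]|not1] := eqVneq #|val w| 1%N.
  have -> : w = pt z by apply: val_inj.
  by rewrite tauE (act_pt _ Gg tg).
apply/setP=> u; rewrite -(permKV tau u) tau_large //.
by rewrite (act_in _ _ Gg tg).
Qed.
End Normalizer.

(** The shifts by elements of G represent each coset of the fibrewise
permutations in their normalizer exactly once. *)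
Lemma vact_quotient : 'N(vact) / vact \isog G.
Proof.
pose f g := coset vact (act (shift g)).
have Nf := act_shift_norm.
have fM : {in G &, {morph f : g h / g * h}}.
  move=> g h Gg Gh; rewrite /f -morphM ?Nf // shiftM.
  by rewrite (actM Gg Gh (@slope_shift g) (@slope_shift h)).
pose fm := Morphism fM.
have -> : 'N(vact) / vact = fm @* G.
  apply/setP=> c; apply/morphimP/morphimP=> [[sigma _ Ns ->]|[g _ Gg ->]];
    last first.
    by exists (act (shift g)); rewrite ?Nf.
  have [tau tauE] := normalizer_perm Ns.
  have [g Gg tg] := tau_slope Ns tauE.
  exists g => //; rewrite /= /f (sigma_act Ns tauE Gg tg).
  have gV : slope (shift g^-1) g^-1 := @slope_shift _.
  pose s := tau * shift g^-1.
  have Ks : s \in vert.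
    by apply/vertP=> z; rewrite (slopeM tg gV) mulgV mulg1.
  have -> : tau = s * shift g.
    rewrite -mulgA -shiftM mulVg; apply/permP=> z.
    by rewrite permM shiftE mulg1 -surjective_pairing.
  rewrite (actM (group1 G) Gg (slope_vert Ks) (@slope_shift g)).
  have Vs : act s \in vact by apply: imset_f.
  apply: etrans (morphM (coset_morphism vact) _ _) _.
  - exact: subsetP (normG _) _ Vs.
  - exact: Nf.
  by rewrite /= coset_id ?mul1g.
rewrite isog_sym; apply: sub_isog => //; apply/subsetP=> g.
case/morphpreP=> Gg /set1P /= /coset_idr -/(_ (Nf g Gg)) /imsetP[s Ks eq_s].
have gg := @slope_shift g.
have eq_gs := act_inj Gg (group1 G) gg (slope_vert Ks) eq_s.
move/vertP: Ks => /(_ (1, ord0)); rewrite -eq_gs shiftE /= mul1g => ->.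
exact: set11.
Qed.
End Profiles.

Theorem mainTheorem2 :
  forall (gT : finGroupType) (G : {group gT}),
    exists (rT : finGroupType) (H : {group rT}), Out H \isog G.
Proof.
move=> gT G; have [rT [H isoH]] := Out_of_normalizer (vact_group G).
by exists rT, H; apply: isog_trans isoH (vact_quotient G).
Qed.
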